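(* At a pure strategy Nash equilibrium (PNE) $\boldsymbol x$ of an $m$-strategy CRS game on a complete network, with $\chi_k=|\{v\in N: x_v=a_k\}|$ denoting the total number of players (of all types) choosing strategy $a_k$: (i) all conformists choose the strictly most common strategy, i.e., they adopt strategy $a_i$ if and only if $\chi_i>\chi_j$ for all $j\neq i$; (ii) the numbers of rebels choosing any two strategies differ by at most one, i.e., if rebels adopt both $a_i$ and $a_j$, then $|\chi_i-\chi_j|\le 1$.
   Context: An $m$-strategy CRS game consists of a finite set of players $N=C\cup R\cup S$ (disjoint union of conformists $C$, rebels $R$ and stubborn agents $S$), a set $E\neq\emptyset$ of undirected edges on $N$ without loops, and a strategy set $A=\{a_1,\dots,a_m\}$ common to all players. $N_i=\{j: ij\in E\}$ is the set of neighbors of $i$. On a complete network every two distinct players are neighbors. Each stubborn agent has a predetermined strategy in $A$ which it never changes. The number of stubborn agents with strategy $a_k$ is $s_k$, and the strategies are labeled, without loss of generality, so that $s_1\le s_2\le\cdots\le s_m$. For a pure strategy profile $\boldsymbol x\in A^N$, $x_i$ is the strategy of player $i$ and $\boldsymbol x_{-i}$ the profile of strategies of the other players. Payoffs are $u_i(\boldsymbol x)=|\{j\in N_i: x_j=x_i\}|$ for $i\in C$, $u_i(\boldsymbol x)=|\{j\in N_i: x_j\ne x_i\}|$ for $i\in R$, and $u_i(\boldsymbol x)=0$ for $i\in S$. A profile $\boldsymbol x^*\in A^N$ (with every stubborn agent at its fixed strategy) is a PNE if $u_i(\boldsymbol x^* )\ge u_i(x_i,\boldsymbol x^*_{-i})$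 for all $i\in N$ and all $x_i\in A$. *)

(* Defs.v *)
From HB Require Import structures.
From mathcomp Require Import all_boot all_order all_algebra.

Set Implicit Arguments.
Unset Strict Implicit.
Unset Printing Implicit Defensive.

(* The disjoint union N = C + R + S, with the predetermined strategy of a
   stubborn agent attached to its role.  The strategy a_k, 1 <= k <= m, is the
   ordinal k - 1 : 'I_m.                                                      *)
Variant role (m : nat) : Type :=
  | Conformist
  | Rebel
  | Stubborn of 'I_m.

Arguments Conformist {m}.
Arguments Rebel {m}.

Definition is_conformist m (r : role m) : bool :=
  if r is Conformist then true else false.

Definition is_rebel m (r : role m) : bool :=
  if r is Rebel then true else false.

Definition is_stubborn_at m (k : 'I_m) (r : role m) : bool :=
  if r is Stubborn a then a == k else false.

Record crs_game (m : nat) (N : finType) : Type := CRSGame {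
  role_of : N -> role m;
  adj : rel N;
  adj_sym : symmetric adj;
  adj_irr : irreflexive adj;
  adj_nonempty : exists u v : N, adj u v;
  (* the labelling convention s_1 <= s_2 <= ... <= s_m *)
  stubborn_sorted : forall k l : 'I_m, k <= l ->
    #|[set v | is_stubborn_at k (role_of v)]|
      <= #|[set v | is_stubborn_at l (role_of v)]|
}.

Section Game.

Variables (m : nat) (N : finType) (G : crs_game m N).

Definition conformists : {set N} := [set v | is_conformist (role_of G v)].
Definition rebels : {set N} := [set v | is_rebel (role_of G v)].

Definition neighbors (v : N) : {set N} := [set w | adj G v w].

Definition complete_network : Prop := forall v w : N, v != w -> adj G v w.

Definition profile : Type := {ffun N -> 'I_m}.

Definition payoff (x : profile) (v : N) : nat :=
  match role_of G v with
  | Conformist => #|[set w in neighbors v | x w == x v]|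
  | Rebel => #|[set w in neighbors v | x w != x v]|
  | Stubborn _ => 0
  end.

Definition deviate (x : profile) (v : N) (a : 'I_m) : profile :=
  [ffun w => if w == v then a else x w].

Definition stubborn_fixed (x : profile) : Prop :=
  forall (v : N) (a : 'I_m), role_of G v = Stubborn a -> x v = a.

Definition PNE (x : profile) : Prop :=
  stubborn_fixed x /\
  forall (v : N) (a : 'I_m), payoff (deviate x v a) v <= payoff x v.

Definition chi (x : profile) (k : 'I_m) : nat := #|[set v | x v == k]|.

End Game.

(* Main.v *)
Require Import Defs.
From mathcomp Require Import all_boot all_order all_algebra.
From mathcomp Require Import zify.

(* On a complete network, player v sees exactly the profile on N minus v, which
   v's own deviation does not affect.  So playing a earns a conformist
   chi_a - [x_v = a] and a rebel |N| - 1 - chi_a + [x_v = a]; comparing this for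
   a = x_v and for the other strategies gives both claims. *)

(** Lets staying put count as a deviation, so that one payoff formula per role also covers the
    equilibrium payoff. *)
Lemma deviate_id m (N : finType) (x : profile m N) (v : N) :
  deviate x v (x v) = x.
Proof. by apply/ffunP => w; rewrite ffunE; case: eqP => [->|]. Qed.

Section CompleteNetwork.

Variables (m : nat) (N : finType) (G : crs_game m N).
Hypothesis Gcomplete : complete_network G.
Implicit Types (x : profile m N) (v : N) (a : 'I_m).

Lemma neighbors_complete v : neighbors G v = [set~ v].
Proof.
apply/setP => w; rewrite !inE; case: (eqVneq w v) => [->|wv].
  by rewrite adj_irr.
by apply: Gcomplete; rewrite eq_sym.
Qed.

Lemma card_others_at x v a : #|[set w | x w == a] :\ v| + (x v == a) = chi x a.
Proof. by rewrite /chi (cardsD1 v [set w | x w == a]) inE addnC. Qed.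

(** The indicator is added on the left, since subtraction on [nat] truncates. *)
Lemma payoff_deviate_conformist x v a : v \in conformists G ->
  payoff G (deviate x v a) v + (x v == a) = chi x a.
Proof.
rewrite inE /payoff; case: (role_of G v) => // _.
rewrite -(card_others_at x v a); congr (_ + _).
apply: eq_card => w; rewrite neighbors_complete !inE !ffunE eqxx.
by case: (w == v).
Qed.

Lemma payoff_deviate_rebel x v a : v \in rebels G ->
  payoff G (deviate x v a) v + chi x a = #|N|.-1 + (x v == a).
Proof.
rewrite inE /payoff; case: (role_of G v) => // _.
rewrite -(card_others_at x v a) addnA -(cardsC1 v); congr (_ + _).
(* The players other than [v] split into those at [a] and those elsewhere; the latter pay the
   rebel. *)
rewrite -(cardsID [set w | x w == a] [set~ v]) addnC.
congr (_ + _); apply: eq_card => w.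
  by rewrite !inE.
rewrite neighbors_complete !inE !ffunE eqxx.
by case: (w == v); rewrite /= ?andbF ?andbT.
Qed.

(** Strictness comes from [v] itself, which is counted in [chi x (x v)] but is not its own
    neighbor. *)
Lemma conformist_strictly_most_common x v a :
  PNE G x -> v \in conformists G -> a != x v -> chi x a < chi x (x v).
Proof.
move=> [_ best] vC ax.
have := payoff_deviate_conformist x v a vC.
have := payoff_deviate_conformist x v (x v) vC.
rewrite deviate_id eqxx eq_sym (negPf ax).
have := best v a; lia.
Qed.

(** The slack of one is again [v] itself; the bound holds even for an [a] that no rebel plays. *)
Lemma rebel_chi_le x v a :
  PNE G x -> v \in rebels G -> chi x (x v) <= (chi x a).+1.
Proof.
move=> [_ best] vR.
have := payoff_deviate_rebel x v a vR.
have := payoff_deviate_rebel x v (x v) vR.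
rewrite deviate_id eqxx.
have := best v a; lia.
Qed.

End CompleteNetwork.

Theorem lemma2 (m : nat) (N : finType) (G : crs_game m N)
    (Gcomplete : complete_network G) (x : profile m N) (xPNE : PNE G x) :
  (forall v : N, v \in conformists G ->
     forall i : 'I_m,
       x v = i <-> (forall j : 'I_m, j != i -> (chi x j < chi x i)%N)) /\
  (forall i j : 'I_m,
     (exists2 v : N, v \in rebels G & x v = i) ->
     (exists2 w : N, w \in rebels G & x w = j) ->
     (`|(chi x i)%:Z - (chi x j)%:Z| <= 1)%R).
Proof.
split=> [v vC i|i j [v vR <-] [w wR <-]].
  have top_v := @conformist_strictly_most_common _ _ _ Gcomplete x v _ xPNE vC.
  split=> [<- j /top_v //|i_max].
  (* Otherwise [i] and [x v] would each be strictly more common than the other. *)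
  apply/eqP/negPn/negP => xvi; have := i_max _ xvi.
  by rewrite ltnNge ltnW // top_v // eq_sym.
have := @rebel_chi_le _ _ _ Gcomplete x v (x w) xPNE vR.
have := @rebel_chi_le _ _ _ Gcomplete x w (x v) xPNE wR.
lia.
Qed.
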